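(* Let $\Omega$ be a locally compact Hausdorff space. Any local $\mathbb{C}$-linear map $\theta$ (not assumed to be bounded) from an essential Banach $C_0(\Omega)$-module $E$ to a Hilbert $C_0(\Omega)$-module $F$ is a $C_0(\Omega)$-module map. Moreover, if $\Omega$ contains no isolated point, then any such $\theta$ is automatically bounded.
   Context: Modules are right modules. A Banach $C_0(\Omega)$-module $E$ is essential if $E\cdot C_0(\Omega)$ has dense linear span in $E$. A $\mathbb{C}$-linear map $\theta:E\to F$ between Banach $C_0(\Omega)$-modules is local if $\theta(e)\cdot\varphi=0$ whenever $e\in E$ and $\varphi\in C_0(\Omega)$ satisfy $e\cdot\varphi=0$. *)

(* Defs.v *)
From HB Require Import structures.
From mathcomp Require Import all_boot all_order all_algebra.
From mathcomp Require Import all_classical all_reals all_analysis.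
From mathcomp Require Import complex.

Set Implicit Arguments.
Unset Strict Implicit.
Unset Printing Implicit Defensive.

Import Order.TTheory GRing.Theory Num.Theory.
Import numFieldNormedType.Exports.

Local Open Scope classical_set_scope.
Local Open Scope ring_scope.
Local Open Scope complex_scope.

Section C0_functions.
Context (R : realType) (Omega : topologicalType).
Implicit Types f g : Omega -> R[i].

Definition vanishes_at_infinity f :=
  forall eps : R, 0 < eps ->
    exists2 K : set Omega, compact K & forall x, ~ K x -> `|f x| < eps%:C.

(* [R[i]^o] is [R[i]] with the topology of its modulus; [R[i]] itself carries
   no topology. *)
Definition C0_pred : {pred (Omega -> R[i])} :=
  fun f => `[< continuous (f : Omega -> R[i]^o) /\ vanishes_at_infinity f >].

Lemma C0_predP f :
  reflect (continuous (f : Omega -> R[i]^o) /\ vanishes_at_infinity f)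
          (f \in C0_pred).
Proof. exact: asboolP. Qed.

Lemma C0_submod_closed : submod_closed C0_pred.
Proof.
split.
  apply/C0_predP; split; first by move=> x; exact: cvg_cst.
  by move=> e e0; exists set0; [exact: compact0 | move=> x _; rewrite normr0 ltcR].
move=> a f g /C0_predP[cf vf] /C0_predP[cg vg]; apply/C0_predP; split.
  move=> x.
  apply: (@cvgD _ R[i]^o _ _ _ ((a *: f) : Omega -> R[i]^o) g); last exact: cg.
  exact: (@cvgM R[i] _ _ _ (cst a) f a (f x) (cvg_cst _) (cf x)).
move=> e e0.
pose c : R := complex.Re `|a| + 1.
have na : `|a| = (complex.Re `|a|)%:C by rewrite RRe_real // normr_real.
have c0 : 0 < c by rewrite ltr_wpDl // -lecR -na normr_ge0.
have ac : `|a| < c%:C by rewrite na ltcR ltrDl.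
have [K cK hK] := vf (e / 2 / c) (divr_gt0 (divr_gt0 e0 (ltr0Sn R 1)) c0).
have [L cL hL] := vg (e / 2) (divr_gt0 e0 (ltr0Sn R 1)).
exists (K `|` L); first exact: compactU.
move=> x /not_orP[/hK fx /hL gx].
apply: (le_lt_trans (ler_normD _ _)).
rewrite [e]splitr rmorphD /=; apply: ltr_leD; last exact: ltW.
rewrite normrM; apply: (@le_lt_trans _ _ (c%:C * `|f x|)).
  by apply: ler_wpM2r => //; exact: ltW.
have -> : (e / 2)%:C = c%:C * (e / 2 / c)%:C.
  by rewrite -rmorphM /= mulrCA divff ?mulr1 // gt_eqF.
by rewrite ltr_pM2l // ltcR.
Qed.

HB.instance Definition _ :=
  GRing.isSubmodClosed.Build R[i] (Omega -> R[i]) C0_pred C0_submod_closed.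

Lemma C0_pred_mul f g :
  f \in C0_pred -> g \in C0_pred -> (fun x => f x * g x) \in C0_pred.
Proof.
move=> /C0_predP[cf vf] /C0_predP[cg vg]; apply/C0_predP; split.
  by move=> x; apply: (@cvgM R[i] _ _ _ f g); [exact: cf | exact: cg].
move=> e e0.
have [K cK hK] := vf e e0.
have [L cL hL] := vg 1 ltr01.
exists (K `|` L); first exact: compactU.
move=> x /not_orP[/hK fx /hL gx].
rewrite normrM -[e%:C]mulr1; exact: ltr_pM.
Qed.

End C0_functions.

(* The algebra C_0(Omega); its linear structure is inherited from
   [Omega -> R[i]].  It has no unit in general, hence no ring instance. *)
Record C0 (R : realType) (Omega : topologicalType) := MkC0 {
  C0_fun :> Omega -> R[i] ;
  C0_funP : C0_fun \in @C0_pred R Omega }.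

Section C0_algebra.
Context (R : realType) (Omega : topologicalType).
Local Notation C0 := (C0 R Omega).

HB.instance Definition _ := [isSub of C0 for @C0_fun R Omega].
HB.instance Definition _ := [Choice of C0 by <:].
HB.instance Definition _ := [SubChoice_isSubLmodule of C0 by <:].

Definition C0_mul (f g : C0) : C0 := MkC0 (C0_pred_mul (C0_funP f) (C0_funP g)).

(* The supremum norm; [`|f x|] is a real element of [R[i]]. *)
Definition C0_norm (f : C0) : R := sup [set complex.Re `|f x| | x in [set: Omega]].

End C0_algebra.

Section C0_modules.
Context (R : realType) (Omega : topologicalType).
Local Notation C0 := (C0 R Omega).

Record is_C0_module (E : lmodType R[i]) (act : E -> C0 -> E) : Prop := {
  actDl : forall e e' phi, act (e + e') phi = act e phi + act e' phi ;
  actZl : forall a e phi, act (a *: e) phi = a *: act e phi ;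
  actDr : forall e phi psi, act e (phi + psi) = act e phi + act e psi ;
  actZr : forall a e phi, act e (a *: phi) = a *: act e phi ;
  actM : forall e phi psi, act e (C0_mul phi psi) = act (act e phi) psi }.

(* The action is only required to be jointly continuous, with some constant;
   contractive actions are the case [k = 1]. *)
Record is_banach_C0_module (E : completeNormedModType R[i])
    (act : E -> C0 -> E) : Prop := {
  banach_C0_module : is_C0_module act ;
  banach_act_bounded : exists k : R, forall e phi,
    `|act e phi| <= k%:C * `|e| * (C0_norm phi)%:C }.

Definition linear_span (E : lmodType R[i]) (A : set E) : set E :=
  [set x | exists (n : nat) (c : 'I_n -> R[i]) (a : 'I_n -> E),
     (forall i, A (a i)) /\ x = \sum_(i < n) c i *: a i].

Definition essential (E : completeNormedModType R[i]) (act : E -> C0 -> E) :=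
  dense (linear_span [set x | exists e phi, x = act e phi]).

(* The inner product is linear in its second argument; completeness for the
   inner product norm is the completeness of [F], by [hilbert_norm]. *)
Record is_hilbert_C0_module (F : completeNormedModType R[i])
    (act : F -> C0 -> F) (ip : F -> F -> C0) : Prop := {
  hilbert_C0_module : is_C0_module act ;
  ipDr : forall x y z, ip x (y + z) = ip x y + ip x z ;
  ipZr : forall a x y, ip x (a *: y) = a *: ip x y ;
  ip_act : forall x y phi, ip x (act y phi) = C0_mul (ip x y) phi ;
  ip_conj : forall x y w, ip y x w = (ip x y w)^* ;
  ip_ge0 : forall x w, 0 <= ip x x w ;
  ip_eq0 : forall x, ip x x = 0 -> x = 0 ;
  hilbert_norm : forall x, `|x| = (Num.sqrt (C0_norm (ip x x)))%:C }.

Section maps.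
Context (E F : completeNormedModType R[i]).
Context (actE : E -> C0 -> E) (actF : F -> C0 -> F).

Definition local_map (theta : E -> F) :=
  forall e phi, actE e phi = 0 -> actF (theta e) phi = 0.

Definition C0_module_map (theta : {linear E -> F}) :=
  forall e phi, theta (actE e phi) = actF (theta e) phi.

Definition bounded_linear_map (theta : {linear E -> F}) :=
  exists M : R, forall e, `|theta e| <= M%:C * `|e|.

End maps.

End C0_modules.

(* Main.v *)
Require Import Defs.
From HB Require Import structures.
From mathcomp Require Import all_boot all_order all_algebra.
From mathcomp Require Import all_classical all_reals all_analysis.
From mathcomp Require Import complex.
From mathcomp Require Import ring lra.

Import Order.TTheory GRing.Theory Num.Theory.
Import numFieldNormedType.Exports.

Local Open Scope classical_set_scope.
Local Open Scope ring_scope.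
Local Open Scope complex_scope.

(* Write q_nu y = <y, y>(nu). If y psi = z psi with psi nu = 1 then q_nu y =
   q_nu z, so q_nu (theta e) only depends on e near nu, by locality of theta.
   Suppose q_nu (theta e) has no bound uniform in the unit ball of E and in nu in
   an open set W without isolated points. Then there are disjoint open sets V_n,
   points nu_n in V_n and e_n in the unit ball with q_(nu_n) (theta e_n) > n 4^n,
   and x = sum_n 2^-n e_n chi_n, with chi_n a bump at nu_n supported in V_n,
   satisfies q_(nu_n) (theta x) > n for all n, contradicting the boundedness of
   <theta x, theta x>. With W = Omega this is the boundedness of theta.
   For the module property put D = theta (e phi) - theta e phi. Near nu one may
   subtract from phi a multiple of a bump, so that phi nu = 0 and
   q_nu D = q_nu (theta (e phi)). If this is not 0, then phi can be cut off to a
   neighbourhood of nu where it is small, so q_nu o theta is unbounded on the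
   unit ball; and nu is not isolated. Hence {nu | q_nu D <> 0} is an open set
   without isolated points contradicting the above, unless it is empty. *)

(** * Supremum norm and bump functions on [Omega] *)

Section C0_facts.
Context {R : realType} {Omega : topologicalType}.
Implicit Types (f g : C0 R Omega) (x y : Omega).

Lemma normC_Re (V : normedZmodType R[i]) (v : V) :
  `|v| = (complex.Re `|v|)%:C.
Proof. by rewrite RRe_real// normr_real. Qed.

Lemma Re_norm_ge0 (V : normedZmodType R[i]) (v : V) :
  0 <= complex.Re `|v|.
Proof. by rewrite -lecR -normC_Re; exact: normr_ge0. Qed.

Lemma C0_dist_lt f x (e : R) :
  0 < e -> \forall y \near x, `|f x - f y| < e%:C.
Proof.
move=> e0; have /C0_predP[cf _] := C0_funP f.
have e0' : 0 < e%:C :> R[i] by rewrite ltcR.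
exact: (@cvgr_dist_lt R[i] R[i]^o _ _ _ _ _ (cf x) _ e0').
Qed.

(** The modulus is below 1 off a compact set and bounded on it by continuity. Hence the set whose
    supremum is [C0_norm f] is bounded above. *)
Lemma C0_bounded f : exists M : R, forall x, `|f x| <= M%:C.
Proof.
have /C0_predP[cf vf] := C0_funP f.
have [K cK hK] := vf 1 ltr01.
pose h x : R^o := complex.Re `|f x|.
have ch : continuous h.
  move=> x; apply/cvgrPdist_lt => e e0.
  near=> y.
  rewrite -ltcR; apply: (@le_lt_trans _ _ `|f x - f y|).
    apply: le_trans (ler_dist_dist _ _).
    apply: le_trans (normc_ge_Re _).
    by rewrite raddfB lexx.
  by near: y; exact: C0_dist_lt.
have [|M [_ /(_ (M + 1))]] := @compact_bounded R R^o (h @` K).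
  apply: continuous_compact => //; exact: continuous_subspaceT.
rewrite ltrDl ltr01 => /(_ isT) hM.
exists (Num.max (M + 1) 1) => x.
rewrite normC_Re lecR le_max.
have [Kx|/hK] := pselect (K x); last first.
  by rewrite normC_Re ltcR => /ltW ->; rewrite orbT.
apply/orP; left; apply: le_trans (hM (h x) _); last by exists x.
exact: ler_norm.
Unshelve. all: by end_near. Qed.

Lemma C0_norm_ge f x : `|f x| <= (C0_norm f)%:C.
Proof.
have [M hM] := C0_bounded f.
rewrite normC_Re lecR; apply: ub_le_sup; last by exists x.
by exists M => _ [y _ <-]; rewrite -lecR -normC_Re.
Qed.

(** [0 <= M] settles an empty [Omega], where [sup] takes the value 0. *)
Lemma C0_norm_le f (M : R) :
  0 <= M -> (forall x, `|f x| <= M%:C) -> C0_norm f <= M.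
Proof.
move=> M0 hM; rewrite /C0_norm.
have [->|/set0P ne] := eqVneq [set complex.Re `|f x| | x in [set: Omega]] set0.
  by rewrite sup0.
by apply: ge_sup => // _ [y _ <-]; rewrite -lecR -normC_Re.
Qed.

Lemma C0_norm_ge0 f : 0 <= C0_norm f.
Proof.
rewrite /C0_norm.
have [->|/set0P[_ [x _ _]]] := eqVneq [set complex.Re `|f x| | x in [set: Omega]] set0.
  by rewrite sup0.
by rewrite -/(C0_norm f) -lecR; exact: le_trans (normr_ge0 _) (C0_norm_ge f x).
Qed.

Lemma C0_eqP f g : (forall x, f x = g x) -> f = g.
Proof. by move=> fg; apply: val_inj; apply/funext. Qed.

Lemma real_C0 (h : Omega -> R) (K : set Omega) :
  continuous h -> compact K -> (forall x, ~ K x -> h x = 0) ->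
  (fun x => (h x)%:C) \in @C0_pred R Omega.
Proof.
move=> ch cK h0; apply/C0_predP; split; last first.
  by move=> e e0; exists K => // x /h0 ->; rewrite normr0 ltcR.
move=> x; apply/cvgrPdist_lt => e e0.
have eE : e = (complex.Re e)%:C by rewrite RRe_real// gtr0_real.
have e0' : 0 < complex.Re e by rewrite -ltcR -eE.
near=> y.
rewrite -rmorphB /= normc_def /= expr0n addr0 sqrtr_sqr eE ltcR.
by near: y; exact: (@cvgr_dist_lt R R^o _ _ _ _ _ (ch x) _ e0').
Unshelve. all: by end_near. Qed.

Section bump.
Context (hausdorff_Omega : hausdorff_space Omega).
Context (locally_compact_Omega : locally_compact [set: Omega]).

(** As [chi] is 1 wherever [psi] is nonzero, cutting off by [chi] is invisible after acting by
    [psi], and [psi x = 1] lets one read off values at [x]. Both are built from one Urysohn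
    function. *)
Lemma bump (V : set Omega) x : nbhs x V ->
  exists chi psi : C0 R Omega, [/\ C0_mul chi psi = psi, psi x = 1,
    forall y, `|chi y| <= 1 & forall y, ~ V y -> chi y = 0].
Proof.
move=> xV.
have [K xK [cK clK]] := locally_compact_Omega x I.
rewrite withinET in xK.
have crs := @locally_compact_completely_regular Omega R
  locally_compact_Omega hausdorff_Omega.
(* Functions vanishing off [W] are supported in [V] and, through [K], compactly. *)
have xVK : nbhs x (V `&` K) by exact: filterI.
move: (xVK); rewrite nbhsE => -[W [oW Wx] WVK].
have := crs x (~` W) (open_closedC oW) (fun h => h Wx).
move=> /(uniform_separatorP (R:=R)) [f0 [cf0 f01 f0x f0W]].
pose f y := 1 - f0 y.
have cf : continuous f by move=> y; apply: cvgB; [exact: cvg_cst|exact: cf0].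
have fW y : ~ W y -> f y = 0.
  by move=> Wy; rewrite /f (f0W (f0 y)) ?subrr//; exists y.
have fx : f x = 1 by rewrite /f (f0x (f0 x)) ?subr0//; exists x.
have f_01 y : 0 <= f y <= 1.
  by have /= := f01 (f0 y) (ex_intro2 _ _ y I erefl); rewrite in_itv/= /f; lra.
(* c = min (1, 2 f) and p = max (0, 2 f - 1), so that c = 1 where p <> 0. *)
pose a y := f y *+ 2 - 1.
have ca : continuous a.
  move=> y; apply: cvgB; [|exact: cvg_cst].
  by apply: cvgMn; exact: cf.
have cna : continuous (fun y => `|a y|) by move=> y; apply: cvg_norm; exact: ca.
pose c y := 2^-1 * (f y *+ 2 + 1 - `|a y|).
pose p y := 2^-1 * (a y + `|a y|).
have cc : continuous c.
  move=> y; apply: cvgM; [exact: cvg_cst|]; apply: cvgB; last exact: cna.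
  apply: cvgD; [apply: cvgMn; exact: cf|exact: cvg_cst].
have cp : continuous p.
  move=> y; apply: cvgM; [exact: cvg_cst|].
  by apply: cvgD; [exact: ca|exact: cna].
have hc y : ~ W y -> c y = 0.
  by move=> /fW; rewrite /c /a => ->; rewrite mul0rn sub0r normrN normr1; lra.
have hp y : ~ W y -> p y = 0.
  by move=> /fW; rewrite /p /a => ->; rewrite mul0rn sub0r normrN normr1; lra.
have WK y : ~ K y -> ~ W y by move=> Ky /WVK[].
have Ic := @real_C0 c K cc cK (fun y h => hc y (WK y h)).
have Ip := @real_C0 p K cp cK (fun y h => hp y (WK y h)).
exists (MkC0 Ic), (MkC0 Ip); split.
- apply: C0_eqP => y /=; rewrite -rmorphM; congr (_%:C).
  by rewrite /c /p /a; case: (ler0P (f y *+ 2 - 1)) => _; lra.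
- rewrite /= /p /a fx; have -> : (1 *+ 2 - 1 : R) = 1 by lra.
  by rewrite normr1 mulVf ?pnatr_eq0.
- move=> y /=; rewrite normc_def /= expr0n addr0 sqrtr_sqr lecR.
  have := f_01 y; rewrite /c /a => /andP[? ?].
  by rewrite ler_norml; case: (ler0P (f y *+ 2 - 1)) => ?; apply/andP; split; lra.
- by move=> y Vy /=; rewrite hc // => /WVK[].
Qed.

End bump.

End C0_facts.

(** * Selection of disjoint open sets, and a comparison test *)

(** At stage n, an open [W] that meets every [B m] contains two points of [B n]. One of them gets a
    neighbourhood, and a smaller open set disjoint from it still meets every [B m] and carries
    on. *)
Lemma disjoint_open_sequence (T : topologicalType) (B : nat -> set T)
    (W0 : set T) :
    hausdorff_space T -> regular_space T ->
    (forall n, open (B n)) -> (forall n m, (n <= m)%N -> B m `<=` B n) ->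
    open W0 -> (forall x, W0 x -> ~ open [set x]) ->
    (forall n, W0 `&` B n !=set0) ->
  exists (V : nat -> set T) (x : nat -> T),
    [/\ forall n, nbhs (x n) (V n), forall n, B n (x n) &
        forall n m, (n < m)%N -> V n `&` V m = set0].
Proof.
move=> hT rT oB mB oW0 iW0 W0B.
pose good W := [/\ open W, W `<=` W0 & forall n, W `&` B n !=set0].
(* [r] packs V_n, its point, and the part of [W] left for later stages. *)
pose ok n W (r : set T * T * set T) :=
  [/\ r.1.1 `<=` W, nbhs r.1.2 r.1.1, B n r.1.2 & r.1.1 `&` r.2 = set0] /\
  (good r.2 /\ r.2 `<=` W).
have step (nW : nat * set T) : exists r, good nW.2 -> ok nW.1 nW.2 r.
  case: nW => n W /=.
  have [gW|ngW] := pselect (good W); last first.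
    (* A dummy value, so that [choice] yields a total function. *)
    by have [x _] := W0B 0; exists (set0, x, set0).
  have [oW WW0 WB] := gW.
  have [x [Wx Bx]] := WB n.
  have oWB : open (W `&` B n) by exact: openI.
  (* Otherwise the open set [W] meets [B n] in [x] alone, and [x] is isolated. *)
  have [y [Wy By yx]] : exists y, [/\ W y, B n y & x != y].
    apply: contrapT => ny; apply: (iW0 x); first exact: WW0.
    rewrite (_ : [set x] = W `&` B n)//; apply/seteqP; split=> [_ ->//|z [Wz Bz]].
    by apply/eqP; apply: contrapT => /negP zx; apply: ny; exists z; rewrite eq_sym.
  move: hT; rewrite open_hausdorff => /(_ _ _ yx) [[A A'] /= [xA yA']].
  rewrite !inE in xA yA'.
  move=> [oA oA' /eqP AA'].
  (* If A misses B m, then removing a closed neighbourhood of x inside A from W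
     loses no point of B m, hence the rest of W still meets all B j. *)
  have [gA|] := pselect (forall m, (W `&` A) `&` B m !=set0).
    exists (W `&` A', y, W `&` A) => _; split; split => //=.
    - by apply: open_nbhs_nbhs; split=> //; exact: openI.
    - by rewrite setIACA setIid [A' `&` A]setIC AA' setI0.
    - split => //; [exact: openI|by move=> z [/WW0]].
  move=> /existsNP [m nm].
  have [C xC CA] := rT x A (open_nbhs_nbhs (conj oA xA)).
  exists (W `&` C, x, W `&` ~` closure C) => _; split; split => //=.
  - by apply: filterI => //; apply: open_nbhs_nbhs; split.
  - rewrite setIACA setIid -subset0 => z [_ [Cz]].
    by case; exact: subset_closure.
  - split.
    + by apply: openI => //; exact/closed_openC/closed_closure.
    + by move=> z [/WW0].
    + move=> j; have [z [Wz Bz]] := WB (maxn j m).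
      exists z; split; last exact: mB (leq_maxl _ _) _ Bz.
      split => // /CA Az; apply: nm; exists z; split=> //.
      exact: mB (leq_maxr _ _) _ Bz.
have [f hf] := choice step.
pose Ws := fix Ws n := if n is n'.+1 then (f (n', Ws n')).2 else W0.
have gWs n : good (Ws n).
  elim: n => [|n ih]; first by split.
  by have [_ []] := hf (n, Ws n) ih.
have okWs n : ok n (Ws n) (f (n, Ws n)) by exact: hf (n, Ws n) (gWs n).
have mWs n m : (n <= m)%N -> Ws m `<=` Ws n.
  elim: m => [|m ih]; first by rewrite leqn0 => /eqP ->.
  rewrite leq_eqVlt => /predU1P[->//|]; rewrite ltnS => /ih.
  by apply: subset_trans; have [_ []] := okWs m.
exists (fun n => (f (n, Ws n)).1.1), (fun n => (f (n, Ws n)).1.2); split.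
- by move=> n; have [[]] := okWs n.
- by move=> n; have [[]] := okWs n.
(* V_m lies in [Ws m], hence in [Ws n.+1] because n < m, and the latter is disjoint from V_n. *)
- move=> n m nm; rewrite -subset0 => z [z1 z2].
  have [[_ _ _ <-] _] := okWs n; split => //.
  apply: (mWs _ _ nm); have [[+ _ _ _] _] := okWs m; exact.
Qed.

(** Comparison through the Cauchy criterion, passing from the [R[i]]-valued norm to a real
    majorant. *)
Lemma series_majorant_cvg (R : realType) (V : completeNormedModType R[i])
    (u : V ^nat) (v : R ^nat) :
  (forall n, `|u n| <= (v n)%:C) -> cvgn (series v) -> cvgn (series u).
Proof.
move=> uv /cauchy_cvgP/cauchy_seriesP cv.
apply/cauchy_cvgP/cauchy_seriesP => e e0.
have eE : e = (complex.Re e)%:C by rewrite RRe_real// gtr0_real.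
have {cv} := cv (complex.Re e); rewrite -ltcR -eE => /(_ e0).
apply: filterS => n /=; rewrite -ltcR -eE; apply: le_lt_trans.
apply: le_trans (ler_norm_sum _ _ _) _.
apply: (@le_trans _ _ (\sum_(n.1 <= k < n.2) v k)%:C).
  by rewrite raddf_sum; apply: ler_sum.
by rewrite lecR ler_norm.
Qed.

(** * Locality and the fibres of [F] *)

Section local_maps.
Context {R : realType} {Omega : topologicalType}.
Context {E : completeNormedModType R[i]} {actE : E -> C0 R Omega -> E}.
Context (banach_E : is_banach_C0_module actE).
Context {F : completeNormedModType R[i]} {actF : F -> C0 R Omega -> F}.
Context {ipF : F -> F -> C0 R Omega}.
Context (hilbert_F : is_hilbert_C0_module actF ipF).
Context {theta : {linear E -> F}} (local_theta : local_map actE actF theta).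

Let modE := banach_C0_module banach_E.
Let modF := hilbert_C0_module hilbert_F.

Lemma act_sum {G : lmodType R[i]} {act : G -> C0 R Omega -> G}
    (modG : is_C0_module act) (u : nat -> G) n phi :
  act (\sum_(0 <= i < n) u i) phi = \sum_(0 <= i < n) act (u i) phi.
Proof.
elim: n => [|n ih]; last by rewrite !big_nat_recr//= (actDl modG) ih.
by rewrite !big_geq//; have := actZl modG 0 0 phi; rewrite !scale0r.
Qed.

Lemma act0r {G : lmodType R[i]} {act : G -> C0 R Omega -> G}
    (modG : is_C0_module act) e : act e 0 = 0.
Proof. by have := actZr modG 0 e 0; rewrite !scale0r. Qed.

Lemma actBl {G : lmodType R[i]} {act : G -> C0 R Omega -> G}
    (modG : is_C0_module act) e e' phi :
  act (e - e') phi = act e phi - act e' phi.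
Proof. by rewrite (actDl modG) -scaleN1r (actZl modG) scaleN1r. Qed.

Lemma actBr {G : lmodType R[i]} {act : G -> C0 R Omega -> G}
    (modG : is_C0_module act) e phi psi :
  act e (phi - psi) = act e phi - act e psi.
Proof. by rewrite (actDr modG) -(scaleN1r psi) (actZr modG) scaleN1r. Qed.

(** Locality, applied to [x - y]. *)
Lemma local_map_eq x y psi :
  actE x psi = actE y psi -> actF (theta x) psi = actF (theta y) psi.
Proof.
move=> xy; apply/eqP; rewrite -subr_eq0 -(actBl modF) -linearB; apply/eqP.
by apply: local_theta; rewrite (actBl modE) xy subrr.
Qed.

(** The constant is made positive so that later estimates can divide by it. *)
Lemma banach_act_le : exists2 k : R, 0 < k & forall e phi,
  `|actE e phi| <= (k * complex.Re `|e| * C0_norm phi)%:C.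
Proof.
have [k hk] := banach_act_bounded banach_E.
exists (`|k| + 1) => [|e phi]; first by rewrite ltr_wpDl.
apply: le_trans (hk e phi) _; rewrite 2!rmorphM /= -normC_Re.
apply: ler_wpM2r; first by rewrite lecR C0_norm_ge0.
by apply: ler_wpM2r => //; rewrite lecR (le_trans (ler_norm k))// lerDl.
Qed.

(** Acting by [psi] multiplies the value of [ipF v v] at [nu] by the squared modulus of [psi nu],
    which is 1. *)
Lemma ip_local y z psi nu :
  actF y psi = actF z psi -> psi nu = 1 -> ipF y y nu = ipF z z nu.
Proof.
move=> yz psi1.
suff h v : ipF v v nu = ipF (actF v psi) (actF v psi) nu by rewrite (h y) yz -h.
rewrite (ip_act hilbert_F) /= psi1 mulr1 [RHS](ip_conj hilbert_F).
by rewrite (ip_act hilbert_F) /= psi1 mulr1 -(ip_conj hilbert_F).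
Qed.

Lemma ipZ (t : R) y nu :
  ipF (t%:C *: y) (t%:C *: y) nu = (t ^+ 2)%:C * ipF y y nu.
Proof.
have CZ (a : R[i]) (f : C0 R Omega) : (a *: f) nu = a * f nu by [].
rewrite (ipZr hilbert_F) CZ (ip_conj hilbert_F) (ipZr hilbert_F) CZ.
rewrite rmorphM /= -(ip_conj hilbert_F) mulrA; congr (_ * _).
by apply/eqP; rewrite eq_complex /=; apply/andP; split; apply/eqP; ring.
Qed.

(** The q_nu of the overview, as a real number. *)
Definition fiber_sqnorm nu y : R := complex.Re (ipF y y nu).

Definition amplifies (C : R) nu :=
  exists2 e : E, `|e| <= 1 & C < fiber_sqnorm nu (theta e).

Lemma fiber_sqnormE nu y : ipF y y nu = (fiber_sqnorm nu y)%:C.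
Proof. by rewrite RRe_real// ger0_real// (ip_ge0 hilbert_F). Qed.

Lemma fiber_sqnorm_le nu y : fiber_sqnorm nu y <= C0_norm (ipF y y).
Proof.
rewrite -lecR -fiber_sqnormE; apply: le_trans (C0_norm_ge _ nu).
by rewrite ger0_norm// (ip_ge0 hilbert_F).
Qed.

(** The same [e] serves near [nu], since [ipF (theta e) (theta e)] is continuous. *)
Lemma open_amplifies (C : R) : open [set nu | amplifies C nu].
Proof.
rewrite openE => nu [e e1 Ce]; rewrite /interior.
have d0 : 0 < fiber_sqnorm nu (theta e) - C by rewrite subr_gt0.
apply: filterS (C0_dist_lt (ipF (theta e) (theta e)) nu _ d0) => y.
rewrite !fiber_sqnormE -rmorphB => h; exists e => //.
have {h} := le_lt_trans (normc_ge_Re _) h; rewrite ltcR /=.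
by rewrite ltr_norml => /andP[_]; lra.
Qed.

(** * The gliding hump *)

Context (hausdorff_Omega : hausdorff_space Omega).
Context (locally_compact_Omega : locally_compact [set: Omega]).
Let bumps := bump (R := R) hausdorff_Omega locally_compact_Omega.

(** The n-th term of the sum has weight 2^-n, which q scales by 4^-n; the factor [4 ^+ n] in the
    threshold makes up for it. *)
Lemma gliding_hump (V : nat -> set Omega) (nu : nat -> Omega) :
  (forall n, nbhs (nu n) (V n)) ->
  (forall n m, (n < m)%N -> V n `&` V m = set0) ->
  ~ (forall n, amplifies (n%:R * 4 ^+ n) (nu n)).
Proof.
move=> nuV disjV amp.
have /choice[e he] n : exists e : E, `|e| <= 1 /\
    n%:R * 4 ^+ n < fiber_sqnorm (nu n) (theta e).
  by have [e] := amp n; exists e.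
have /choice[cp hcp] n : exists cp : C0 R Omega * C0 R Omega,
    [/\ C0_mul cp.1 cp.2 = cp.2, cp.2 (nu n) = 1,
        forall y, `|cp.1 y| <= 1 & forall y, ~ V n y -> cp.1 y = 0].
  by have [c [p ?]] := bumps _ _ (nuV n); exists (c, p).
pose chi n := (cp n).1; pose psi n := (cp n).2.
have [k k0 hk] := banach_act_le.
pose h n : R := 2^-1 ^+ n.
have h0 n : 0 < h n by rewrite exprn_gt0.
pose u n : E := (h n)%:C *: actE (e n) (chi n).
have uk n : `|u n| <= (geometric k 2^-1 n)%:C.
  rewrite normrZ ger0_norm; last by rewrite lecR ltW.
  rewrite (_ : (geometric k 2^-1 n)%:C = (h n)%:C * k%:C); last first.
    by rewrite -rmorphM mulrC.
  apply: ler_wpM2l; first by rewrite lecR ltW.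
  apply: le_trans (hk _ _) _; rewrite lecR -mulrA; apply: ler_piMr (ltW k0) _.
  have [_ _ chi1 _] := hcp n.
  apply: mulr_ile1; rewrite ?C0_norm_ge0//.
  - exact: Re_norm_ge0.
  - by rewrite -lecR -normC_Re; exact: (he n).1.
  - by apply: C0_norm_le.
have /cvg_ex[x /= ux] : cvgn (series u).
  apply: series_majorant_cvg uk _; apply: is_cvg_geometric_series.
  by rewrite ger0_norm ?invr_ge0// invf_lt1// ltr1n.
(* [psi n] absorbs [chi n], and [chi m], [chi n] have disjoint supports. *)
have chipsi m n : m != n -> C0_mul (chi m) (psi n) = 0.
  move=> mn; apply: C0_eqP => y /=.
  have [psiE _ _ _] := hcp n; rewrite -/(psi n) -/(chi n) in psiE.
  rewrite -psiE /= mulrA.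
  suff -> : chi m y * chi n y = 0 by rewrite mul0r.
  have disj : ~ (V m y /\ V n y).
    move=> [Vm Vn]; move: mn; rewrite neq_ltn => /orP[mn|nm].
      by have /seteqP[dj _] := disjV _ _ mn; exact: (dj y).
    by have /seteqP[dj _] := disjV _ _ nm; exact: (dj y).
  have [_ _ _ hm] := hcp m; have [_ _ _ hn] := hcp n.
  have [Vm|/hm ->] := pselect (V m y); last by rewrite mul0r.
  by rewrite [chi n y]hn ?mulr0// => Vn; apply: disj.
have upsi n m : actE (u m) (psi n) =
    if m == n then actE ((h n)%:C *: e n) (psi n) else 0.
  rewrite (actZl modE) -(actM modE); case: eqVneq => [->|mn].
    by have [-> _ _ _] := hcp n; rewrite (actZl modE).
  by rewrite chipsi// (act0r modE) scaler0.
have spsi n N : (n < N)%N ->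
    actE (series u N) (psi n) = actE ((h n)%:C *: e n) (psi n).
  move=> nN; rewrite /series/= (act_sum modE).
  under eq_bigr do rewrite upsi.
  by rewrite -big_mkcond/= big_nat1_eq nN.
(* By continuity of the action: after acting by [psi n], all partial sums beyond index n agree with
   the n-th term. *)
have xpsi n : actE x (psi n) = actE ((h n)%:C *: e n) (psi n).
  apply/eqP; rewrite -subr_eq0 -normr_eq0 normC_Re; apply/eqP; congr (_%:C).
  apply/eqP; rewrite eq_le; apply/andP; split; last exact: Re_norm_ge0.
  apply/ler_addgt0Pr => d d0; rewrite add0r.
  pose K := k * (C0_norm (psi n) + 1).
  have K0 : 0 < K by rewrite mulr_gt0// ltr_wpDl// C0_norm_ge0.
  have dK0 : 0 < (d / K)%:C :> R[i] by rewrite ltcR divr_gt0.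
  have [N _ hN] := @cvgr_dist_lt R[i] E _ _ _ _ _ ux _ dK0.
  pose N' := maxn N n.+1.
  rewrite -(spsi n N'); last by rewrite leq_max ltnSn orbT.
  rewrite -(actBl modE) -lecR -normC_Re; apply: le_trans (hk _ _) _.
  have := hN N' (leq_maxl _ _); rewrite /= normC_Re !(ltcR, lecR) => xd.
  apply: (@le_trans _ _ (k * (d / K) * (C0_norm (psi n) + 1))).
    apply: ler_pM; rewrite ?C0_norm_ge0 ?lerDl//.
      exact: mulr_ge0 (ltW k0) (Re_norm_ge0 _ _).
    by rewrite ler_pM2l// ltW.
  by rewrite mulrAC -/K mulrC divfK// gt_eqF.
(* Locality carries [xpsi] over to [theta], so at [nu n] only the n-th term counts. *)
have big n : n%:R < C0_norm (ipF (theta x) (theta x)).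
  apply: lt_le_trans (fiber_sqnorm_le (nu n) (theta x)).
  have [_ psi1 _ _] := hcp n; have [_ en] := he n.
  rewrite -ltcR -fiber_sqnormE (ip_local _ _ _ _ (local_map_eq _ _ _ (xpsi n)) psi1).
  rewrite linearZ ipZ fiber_sqnormE -rmorphM/= ltcR.
  rewrite /h -exprM mulnC exprM -ltr_pdivrMl ?exprn_gt0//.
  apply: le_lt_trans en; rewrite mulrC le_eqVlt; apply/orP; left.
  by rewrite -exprVn expr2 invfM invrK -natrM.
have := big (Num.bound (C0_norm (ipF (theta x) (theta x)))).
by apply/negP; rewrite -leNgt; apply/ltW/archi_boundP/C0_norm_ge0.
Qed.

(** If every bound fails, the open sets for the thresholds n 4^n decrease and all meet [W], as the
    selection of disjoint sets requires. *)
Lemma amplifies_bounded (W : set Omega) :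
  open W -> (forall nu, W nu -> ~ open [set nu]) ->
  exists C, forall nu, W nu -> ~ amplifies C nu.
Proof.
move=> oW iW; apply: contrapT => /forallNP nb.
have regO : regular_space Omega.
  exact/(@completely_regular_regular R)/locally_compact_completely_regular.
have [||n|V [nu [nuV amp disj]]] := @disjoint_open_sequence Omega
  (fun n => [set nu | amplifies (n%:R * 4 ^+ n) nu]) W
  hausdorff_Omega regO _ _ oW iW.
- by move=> n; exact: open_amplifies.
- move=> n m nm nu [e e1 he]; exists e => //; apply: le_lt_trans he.
  apply: ler_pM; rewrite ?exprn_ge0// ?ler_nat//.
  by rewrite ler_weXn2l// ler1n.
- have /existsNP[nu /not_implyP[Wnu /contrapT amp]] := nb (n%:R * 4 ^+ n).
  by exists nu.
- exact: gliding_hump nuV disj amp.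
Qed.

(** * The module property *)

Lemma ip_subr_act x a b (phi : C0 R Omega) nu :
  phi nu = 0 -> ipF x (a - actF b phi) nu = ipF x a nu.
Proof.
move=> phi0; rewrite (ipDr hilbert_F) -scaleN1r (ipZr hilbert_F).
rewrite (ip_act hilbert_F).
have -> : (ipF x a + -1 *: C0_mul (ipF x b) phi) nu =
  ipF x a nu + -1 * (ipF x b nu * phi nu) by [].
by rewrite phi0 !mulr0 addr0.
Qed.

Let defect e phi := theta (actE e phi) - actF (theta e) phi.

(** Take [phi0] to be [phi] minus [phi nu] times a bump [chi]. The defect of [chi] dies under [psi],
    and [actF (theta e) phi0] drops out of inner products at [nu]. *)
Lemma ip_defect e phi nu : exists2 phi0 : C0 R Omega, phi0 nu = 0 &
  ipF (defect e phi) (defect e phi) nu =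
  ipF (theta (actE e phi0)) (theta (actE e phi0)) nu.
Proof.
have [chi [psi [chipsi psi1 _ _]]] := bumps _ _ (@filterT _ _ (nbhs_filter nu)).
have chi1 : chi nu = 1.
  by have := congr1 (fun f : C0 R Omega => f nu) chipsi; rewrite /= psi1 mulr1.
pose a := phi nu; pose phi0 := phi - a *: chi.
have phi00 : phi0 nu = 0.
  have -> : phi0 nu = phi nu - a * chi nu by [].
  by rewrite chi1 mulr1 subrr.
exists phi0 => //.
pose y := theta (actE e phi0) - actF (theta e) phi0.
have chiE : actF (theta (actE e chi)) psi = actF (theta e) psi.
  by apply: local_map_eq; rewrite -(actM modE) chipsi.
have Dy : actF (defect e phi) psi = actF y psi.
  rewrite /y /defect /phi0 (actBr modE) (actBr modF) linearB !(actBl modF).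
  rewrite (actZr modE) (actZr modF) linearZ !(actZl modF) chiE.
  by rewrite -[actF (actF (theta e) chi) psi](actM modF) chipsi opprB addrA subrK.
rewrite (ip_local _ _ _ _ Dy psi1) {2}/y ip_subr_act//.
by rewrite (ip_conj hilbert_F) {1}/y ip_subr_act// -(ip_conj hilbert_F).
Qed.

(** Cutting [phi] off to where it is small shrinks [actE e phi] but, by locality, keeps q_nu of its
    image; rescaling then beats [C]. *)
Lemma amplifies_of_vanishing e (phi : C0 R Omega) nu C : phi nu = 0 ->
  ipF (theta (actE e phi)) (theta (actE e phi)) nu != 0 -> amplifies C nu.
Proof.
move=> phi0 ne0.
pose d := fiber_sqnorm nu (theta (actE e phi)).
have d0 : 0 < d.
  by rewrite -ltcR -fiber_sqnormE lt_def ne0 (ip_ge0 hilbert_F).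
have [k k0 hk] := banach_act_le.
(* Chosen so that t d > C; as t > 1, also t^2 d > C. *)
pose t : R := (`|C| + 1) / d + 1.
have Cd0 : 0 < (`|C| + 1) / d by rewrite divr_gt0// ltr_wpDl.
have t1 : 1 < t by rewrite ltrDr.
have t0 : 0 < t := lt_trans ltr01 t1.
(* Functions of norm at most 1/K move [e] to norm at most 1/t; the [+ 1] keeps [K] positive when [e]
   is 0. *)
pose K := t * (k * (complex.Re `|e| + 1)).
have K0 : 0 < K by rewrite !mulr_gt0// ltr_wpDl// Re_norm_ge0.
have eps0 : 0 < K^-1 by rewrite invr_gt0.
have [chi [psi [chipsi psi1 chi1 chiV]]] :=
  bumps _ _ (C0_dist_lt phi nu _ eps0).
exists (t%:C *: actE e (C0_mul phi chi)).
  rewrite normrZ ger0_norm; last by rewrite lecR ltW.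
  rewrite normC_Re -rmorphM lecR.
  apply: (@le_trans _ _ (t * (k * (complex.Re `|e| + 1) * K^-1))); last first.
    by rewrite mulrA -/K divff// gt_eqF.
  rewrite ler_pM2l// -lecR -normC_Re; apply: le_trans (hk _ _) _; rewrite lecR.
  apply: ler_pM; rewrite ?C0_norm_ge0//.
  - exact: mulr_ge0 (ltW k0) (Re_norm_ge0 _ _).
  - by rewrite ler_pM2l// lerDl.
  apply: C0_norm_le => [|y /=]; first exact: ltW.
  have [Vy|/chiV ->] := pselect (`|phi nu - phi y| < (K^-1)%:C); last first.
    by rewrite mulr0 normr0 lecR ltW.
  rewrite normrM -[leRHS]mulr1; apply: ler_pM => //.
  by move: Vy; rewrite phi0 sub0r normrN => /ltW.
have eqpsi : actE (actE e (C0_mul phi chi)) psi = actE (actE e phi) psi.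
  by rewrite (actM modE) -(actM modE (actE e phi)) chipsi.
rewrite -ltcR -fiber_sqnormE linearZ ipZ.
rewrite (ip_local _ _ _ _ (local_map_eq _ _ _ eqpsi) psi1) fiber_sqnormE.
rewrite -rmorphM/= ltcR -/d.
apply: (@lt_le_trans _ _ (t * d)); last first.
  by rewrite ler_pM2r// expr2 ler_peMl// ltW.
rewrite /t mulrDl mul1r divfK ?gt_eqF//.
by have := ler_norm C; lra.
Qed.

(** A bump supported at [nu] alone kills [phi], so locality makes [psi] kill the image, although
    [psi nu = 1]. *)
Lemma isolated_vanishing e (phi : C0 R Omega) nu : open [set nu] -> phi nu = 0 ->
  ipF (theta (actE e phi)) (theta (actE e phi)) nu = 0.
Proof.
move=> onu phi0.
have nunu : nbhs nu [set nu] by apply: open_nbhs_nbhs.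
have [chi [psi [chipsi psi1 _ chiV]]] := bumps _ _ nunu.
have : actF (theta (actE e phi)) psi = 0.
  apply: local_theta; rewrite -(actM modE) (_ : C0_mul phi psi = 0) ?(act0r modE)//.
  apply: C0_eqP => y; rewrite -chipsi /=.
  have [->|/chiV ->] := pselect (y = nu); first by rewrite phi0 mul0r.
  by rewrite mul0r mulr0.
move=> act0; rewrite -[LHS]mulr1 -psi1.
rewrite -[LHS]/(C0_mul _ _ nu) -(ip_act hilbert_F) act0.
by have := ipZr hilbert_F 0 (theta (actE e phi)) 0; rewrite !scale0r => ->.
Qed.

Lemma local_map_module_map e phi : theta (actE e phi) = actF (theta e) phi.
Proof.
apply/eqP; rewrite -subr_eq0 -/(defect e phi); apply/eqP.
apply: (ip_eq0 hilbert_F); apply: C0_eqP => nu0; apply/eqP/negPn/negP => ne0.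
pose f := ipF (defect e phi) (defect e phi).
pose W := [set nu | f nu != 0].
have [||C hC] := @amplifies_bounded W.
- rewrite openE => nu /= fnu; rewrite /interior.
  have n0 : 0 < complex.Re `|f nu| by rewrite -ltcR -normC_Re normr_gt0.
  apply: filterS (C0_dist_lt f nu _ n0) => y; rewrite -normC_Re /W /=.
  by apply: contraTneq => ->; rewrite subr0 ltxx.
- move=> nu /= /negP fnu onu; apply: fnu; rewrite /f.
  have [phi0 phi00 ->] := ip_defect e phi nu.
  by rewrite isolated_vanishing.
apply: (hC nu0) => //; have [phi0 phi00 E0] := ip_defect e phi nu0.
by apply: (amplifies_of_vanishing e phi0) => //; rewrite -E0.
Qed.

(** * Automatic boundedness *)

Lemma local_map_bounded : isolated [set: Omega] = set0 ->
  exists M : R, forall e, `|theta e| <= M%:C * `|e|.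
Proof.
move=> iso0.
have [||C hC] := @amplifies_bounded setT; first exact: openT.
  move=> nu _ onu; have : isolated [set: Omega] nu.
    split; first by rewrite in_setE.
    by exists [set nu]; [exact: open_nbhs_nbhs|rewrite setIT].
  by rewrite iso0.
(* [C] bounds every q_nu on the image of the unit ball, and the squared norm of [F] is their
   supremum; the modulus guards against a negative [C]. *)
exists (Num.sqrt `|C|) => e.
have [->|e0] := eqVneq e 0; first by rewrite linear0 !normr0 mulr0.
pose t := complex.Re `|e|.
have t0 : 0 < t by rewrite -ltcR -normC_Re normr_gt0.
rewrite (hilbert_norm hilbert_F) [`|e|]normC_Re -/t -rmorphM/= lecR.
rewrite -[t in leRHS](ger0_norm (ltW t0)) -(sqrtr_sqr t) -sqrtrM// ler_sqrt; last first.
  by rewrite mulr_ge0// sqr_ge0.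
apply: C0_norm_le => [|nu]; first by rewrite mulr_ge0// sqr_ge0.
pose e1 := (t^-1)%:C *: e.
have eE : e = t%:C *: e1.
  by rewrite scalerA -rmorphM mulfV ?gt_eqF// scale1r.
have e1n : `|e1| <= 1.
  rewrite normrZ ger0_norm; last by rewrite lecR invr_ge0 ltW.
  by rewrite [`|e|]normC_Re -/t -rmorphM mulVf ?gt_eqF.
rewrite ger0_norm; last exact: (ip_ge0 hilbert_F).
rewrite eE linearZ ipZ fiber_sqnormE -rmorphM/= lecR mulrC ler_pM2r ?exprn_gt0//.
apply: le_trans (ler_norm C); rewrite leNgt; apply/negP => h.
by apply: (hC nu I); exists e1.
Qed.

End local_maps.

Theorem corollary4p4 (R : realType) (Omega : topologicalType)
    (hausdorff_Omega : hausdorff_space Omega)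
    (locally_compact_Omega : locally_compact [set: Omega])
    (E : completeNormedModType R[i]) (actE : E -> C0 R Omega -> E)
    (banach_E : is_banach_C0_module actE) (essential_E : essential actE)
    (F : completeNormedModType R[i]) (actF : F -> C0 R Omega -> F)
    (ipF : F -> F -> C0 R Omega) (hilbert_F : is_hilbert_C0_module actF ipF)
    (theta : {linear E -> F}) (local_theta : local_map actE actF theta) :
  C0_module_map actE actF theta /\
  (isolated [set: Omega] = set0 -> bounded_linear_map theta).
Proof.
split=> [e phi|iso0].
  exact: (local_map_module_map banach_E hilbert_F local_theta).
exact: (local_map_bounded banach_E hilbert_F local_theta).
Qed.
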